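(* Let $H$ be an infinite-dimensional separable Hilbert space. Then the Calkin algebra $B(H)/K(H)$ fails the ball-covering property.
   Context: $B(H)$ is the space of bounded linear operators on $H$ with the operator norm, $K(H)$ the ideal of compact operators, and $B(H)/K(H)$ carries the quotient norm. A normed space $Y$ with unit sphere $S_Y$ has the ball-covering property (BCP) if there is a sequence of open balls $(B(y_n,r_n))_{n=1}^\infty$ in $Y$ with $S_Y\subseteq\bigcup_{n=1}^\infty B(y_n,r_n)$ and $0\notin B(y_n,r_n)$ for every $n$; it fails the BCP if it does not have it. *)

(* Defs.v *)
From HB Require Import structures.
From mathcomp Require Import all_boot all_order all_algebra finmap.
From mathcomp Require Import all_classical all_reals all_analysis.
From mathcomp Require Import complex generic_quotient ring_quotient.
From mathcomp Require Import sesquilinear.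

Set Implicit Arguments.
Unset Strict Implicit.
Unset Printing Implicit Defensive.

Import Order.TTheory GRing.Theory Num.Theory.
Import numFieldNormedType.Exports.
Local Open Scope classical_set_scope.
Local Open Scope complex_scope.
Local Open Scope ring_scope.

Variant scalar_kind := real_scalars | complex_scalars.

Definition scalar_field (R : realType) (k : scalar_kind) : numFieldType :=
  match k with real_scalars => R | complex_scalars => R[i] end.

Definition conj_scalar (R : realType) (k : scalar_kind) : scalar_field R k -> scalar_field R k :=
  match k with real_scalars => fun x => x | complex_scalars => @conjc R end.

Definition to_real (R : realType) (k : scalar_kind) : scalar_field R k -> R :=
  match k with real_scalars => fun x => x | complex_scalars => @complex.Re R end.

Definition of_real (R : realType) (k : scalar_kind) : R -> scalar_field R k :=
  match k with real_scalars => fun x => x | complex_scalars => @real_complex R end.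

(* In MathComp-Analysis the norm of a normed space over K takes its values in K
   itself; [ksup] and [kinf] are the supremum and the infimum of a set of such
   values, that is, of real elements of K. *)
Definition ksup (R : realType) (k : scalar_kind) (A : set (scalar_field R k)) :=
  of_real k (sup (@to_real R k @` A)).

Definition kinf (R : realType) (k : scalar_kind) (A : set (scalar_field R k)) :=
  of_real k (inf (@to_real R k @` A)).

Section scalar_theory.
Variables (R : realType) (k : scalar_kind).
Local Notation K := (scalar_field R k).

Lemma of_realK (x : R) : to_real (of_real k x) = x.
Proof. by case: k. Qed.

Lemma to_realK (x : K) : 0 <= x -> of_real k (to_real x) = x.
Proof.
case: k x => // x; case: x => a b.
by rewrite /= lecE /= => /andP[/eqP -> _].
Qed.

Lemma ler_of_real (x y : R) : (of_real k x <= of_real k y) = (x <= y).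
Proof. by case: k => //=; rewrite lecR. Qed.

Lemma ltr_of_real (x y : R) : (of_real k x < of_real k y) = (x < y).
Proof. by case: k => //=; rewrite ltcR. Qed.

Lemma of_real0 : of_real k 0 = 0 :> K.
Proof. by case: k. Qed.

Lemma of_realD (x y : R) : of_real k (x + y) = of_real k x + of_real k y.
Proof. by case: k => //=; rewrite rmorphD. Qed.

Lemma of_real_ge0 (x : R) : (0 <= of_real k x) = (0 <= x).
Proof. by rewrite -of_real0 ler_of_real. Qed.

Lemma to_real_ge0 (x : K) : 0 <= x -> 0 <= to_real x.
Proof. by move=> x0; rewrite -of_real_ge0 to_realK. Qed.

Lemma to_real_le (x y : K) : 0 <= x -> x <= y -> to_real x <= to_real y.
Proof.
by move=> x0 xy; rewrite -ler_of_real !to_realK // (le_trans x0).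
Qed.

Lemma ksup_ub (A : set K) (M a : K) : (forall x, A x -> 0 <= x <= M) ->
  A a -> a <= ksup A.
Proof.
move=> AM Aa; have /andP[a0 aM] := AM _ Aa.
rewrite -(to_realK a0) /ksup ler_of_real; apply: ub_le_sup; last by exists a.
by exists (to_real M) => _ [x /AM/andP[x0 xM] <-]; exact: to_real_le.
Qed.

Lemma ksup_le (A : set K) (M : K) : A !=set0 -> (forall x, A x -> 0 <= x <= M) ->
  ksup A <= M.
Proof.
move=> [a Aa] AM; have /andP[a0 aM] := AM _ Aa.
rewrite -[leRHS]to_realK ?(le_trans a0)// /ksup ler_of_real.
apply: ge_sup; first by exists (to_real a), a.
by move=> _ [x /AM/andP[x0 xM] <-]; exact: to_real_le.
Qed.

Lemma kinf_lb (A : set K) (a : K) : (forall x, A x -> 0 <= x) ->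
  A a -> kinf A <= a.
Proof.
move=> A0 Aa; rewrite -(to_realK (A0 _ Aa)) /kinf ler_of_real.
apply: ge_inf; last by exists a.
by exists 0 => _ [x /A0 x0 <-]; exact: to_real_ge0.
Qed.

Lemma kinf_ge (A : set K) (m : K) : A !=set0 -> 0 <= m ->
  (forall x, A x -> m <= x) -> m <= kinf A.
Proof.
move=> [a Aa] m0 mA; rewrite -(to_realK m0) /kinf ler_of_real.
apply: lb_le_inf; first by exists (to_real a), a.
by move=> _ [x /mA mx <-]; exact: to_real_le.
Qed.

Lemma kinf_adherent (A : set K) (e : K) : A !=set0 -> (forall x, A x -> 0 <= x) ->
  0 < e -> exists2 x, A x & x < kinf A + e.
Proof.
move=> [a Aa] A0 e0.
have := @inf_adherent R (@to_real R k @` A) (to_real e).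
rewrite -ltr_of_real of_real0 to_realK ?(ltW e0)// => /(_ e0)[].
  split; first by exists (to_real a), a.
  by exists 0 => _ [x /A0 x0 <-]; exact: to_real_ge0.
move=> _ [x Ax <-] xe; exists x => //.
move: xe; rewrite -ltr_of_real to_realK ?A0//.
suff -> : of_real k (inf [set to_real x | x in A] + to_real e) = kinf A + e by [].
by rewrite -[in RHS](to_realK (ltW e0)) /kinf of_realD.
Qed.

End scalar_theory.

Section finite_dimension.
Variables (K : numFieldType) (V : lmodType K).

Definition finite_dimensional := exists (n : nat) (e : 'I_n -> V),
  forall x, exists c : 'I_n -> K, x = \sum_(i < n) c i *: e i.

End finite_dimension.

Definition separable_space (T : topologicalType) :=
  exists2 D : set T, countable D & dense D.

Section bounded_operators.
Variables (K : numFieldType) (V : normedModType K).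

Definition bounded_operator : {pred V -> V} :=
  fun T => `[< linear T /\ exists M : K, forall x, `|T x| <= M * `|x| >].

Lemma bounded_operatorP (T : V -> V) : reflect
  (linear T /\ exists M : K, forall x, `|T x| <= M * `|x|)
  (T \in bounded_operator).
Proof. exact: asboolP. Qed.

Lemma bounded_operator_submod : submod_closed bounded_operator.
Proof.
split=> [|a S T /bounded_operatorP[Sl [M SM]] /bounded_operatorP[Tl [N TN]]].
  apply/bounded_operatorP; split.
    by move=> a x y; rewrite /GRing.zero /= scaler0 addr0.
  by exists 0 => x; rewrite mul0r /GRing.zero /= normr0.
apply/bounded_operatorP; split.
  move=> b x y; rewrite /GRing.add /GRing.scale /= -!/(_ + _) -!/(_ *: _).
  by rewrite Sl Tl !scalerDr !scalerA [a * b]mulrC addrACA.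
exists (`|a| * M + N) => x; rewrite /GRing.add /GRing.scale /=.
rewrite (le_trans (ler_normD _ _))// mulrDl lerD// normrZ -mulrA.
by rewrite ler_wpM2l.
Qed.

HB.instance Definition _ :=
  GRing.isSubmodClosed.Build K (V -> V) bounded_operator bounded_operator_submod.

Record bop := Bop { bop_fun :> V -> V ; bop_funP : bop_fun \in bounded_operator }.

HB.instance Definition _ := [isSub of bop for bop_fun].
HB.instance Definition _ := [Choice of bop by <:].
HB.instance Definition _ := [SubChoice_isSubLmodule of bop by <:].

Lemma bop_linear (T : bop) : linear T.
Proof. by have /bounded_operatorP[] := bop_funP T. Qed.

HB.instance Definition _ (T : bop) :=
  GRing.isLinear.Build K V V *:%R (bop_fun T) (bop_linear T).

Definition compact_operator : {pred bop} :=
  fun T => `[< precompact (T @` [set x | `|x| <= 1]) >].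

End bounded_operators.

Section compact_operators.
Variables (K : numFieldType) (V : completeNormedModType K).

Lemma compact_operatorP (T : bop V) :
  reflect (precompact (T @` [set x | `|x| <= 1])) (T \in @compact_operator K V).
Proof. exact: asboolP. Qed.

Lemma precompactP (A : set V) :
  precompact A <-> exists2 C : set V, A `<=` C & compact C.
Proof.
split=> [[C AC [cC _]]|[C AC cC]]; first by exists C.
by apply: (precompact_subset AC); exact: compact_precompact.
Qed.

Lemma compact_operator_submod : submod_closed (@compact_operator K V).
Proof.
split=> [|a S T /compact_operatorP/precompactP[C SC cC]
             /compact_operatorP/precompactP[D TD cD]].
  apply/compact_operatorP/precompactP; exists [set 0]; last exact: compact_set1.
  by move=> _ [x _ <-]; exact: erefl.
apply/compact_operatorP/precompactP.
exists ((fun p : V * V => a *: p.1 + p.2) @` (C `*` D)).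
  move=> _ [x x1 <-]; exists (S x, T x) => //=.
  by split; [apply: SC; exists x|apply: TD; exists x].
apply: continuous_compact; last exact: compact_setX.
apply: continuous_subspaceT => p.
apply: (@cvgD K V _ (nbhs p) _ (fun p : V * V => a *: p.1)); last exact: cvg_snd.
by apply: cvgZr; exact: cvg_fst.
Qed.

HB.instance Definition _ :=
  GRing.isSubmodClosed.Build K (bop V) (@compact_operator K V)
    compact_operator_submod.

Lemma totally_bounded_precompact (A : set V) :
  (forall e : K, 0 < e -> exists2 D : set V, finite_set D &
     A `<=` \bigcup_(c in D) ball c e) -> precompact A.
Proof.
move=> Atb; rewrite precompactE compact_ultra => F FU FA.
suff /cauchy_cvgP/cvg_ex[p Fp] : cauchy F.
  exists p; split=> //; have /closure_id-> := @closed_closure _ A.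
  by move=> B /Fp FB; exact: (@filter_ex _ F _ (closure A `&` B) (filterI FA FB)).
apply: cauchy_exP => e e0; have e20 : 0 < e / 2 by rewrite divr_gt0.
have [D /finite_fsetP[X ->] AX] := Atb _ e20.
have [[c cX Fc]|nF] := pselect (exists2 c, [set` X] c & F (ball c e)).
  by exists c.
exfalso; apply: (@filter_not_empty _ F).
have : F (\bigcap_(c in [set` X]) ~` ball c e).
  apply: filter_bigI => c cX.
  by case: (in_ultra_setVsetC (ball c e) FU) => // Fc; case: nF; exists c.
move=> FI; apply: filterS (filterI FA FI) => y [Ay Iy].
have [z [Az yz]] := Ay _ (nbhsx_ballx y _ e20).
have [c cX cz] := AX _ Az.
apply: (Iy c cX); rewrite [e]splitr.
exact: ball_triangle cz (ball_sym yz).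
Qed.

Lemma precompact_totally_bounded (A : set V) (e : K) : 0 < e -> precompact A ->
  exists2 D : set V, finite_set D & A `<=` \bigcup_(c in D) ball c e.
Proof.
move=> e0; rewrite precompactE compact_cover => cA.
have [||D _ AD] := cA V setT (fun c => (ball c e)^°).
- by move=> c _; exact: open_interior.
- by move=> x _; exists x => //; exact: nbhsx_ballx.
exists [set` D] => // x Ax; have [|c cD cx] := AD x; first exact: subset_closure.
by exists c => //; exact: interior_subset.
Qed.

Lemma compact_operator_closed (T : bop V) :
  (forall e : K, 0 < e -> exists2 S, S \in @compact_operator K V &
     forall x, `|x| <= 1 -> `|T x - S x| < e) -> T \in @compact_operator K V.
Proof.
move=> Tlim; apply/compact_operatorP/totally_bounded_precompact => e e0.
have e20 : 0 < e / 2 by rewrite divr_gt0.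
have [S /compact_operatorP cS TS] := Tlim _ e20.
have [D fD SD] := precompact_totally_bounded e20 cS.
exists D => // _ [x x1 <-]; have [|c Dc cx] := SD (S x); first by exists x.
exists c => //; rewrite [e]splitr; apply: ball_triangle cx _.
by rewrite -ball_normE /ball_ /= distrC TS.
Qed.

End compact_operators.

Section operator_norm.
Variables (R : realType) (k : scalar_kind) (V : normedModType (scalar_field R k)).
Local Notation K := (scalar_field R k).

Definition opnorm (T : bop V) : K :=
  ksup [set `|T x| | x in [set x : V | `|x| <= 1]].

Lemma opnorm_le (T : bop V) (M : K) : 0 <= M ->
  (forall x, `|T x| <= M * `|x|) -> opnorm T <= M.
Proof.
move=> M0 TM; apply: ksup_le; first by exists `|T 0|, 0 => //=; rewrite normr0.
move=> _ [x /= x1 <-]; rewrite normr_ge0 (le_trans (TM x))//.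
by rewrite -[leRHS]mulr1 ler_wpM2l.
Qed.

Lemma bop_bounded (T : bop V) :
  exists2 M : K, 0 <= M & forall x, `|T x| <= M * `|x|.
Proof.
have /bounded_operatorP[_ [M TM]] := bop_funP T; exists `|M| => // x.
by rewrite (le_trans (TM x))// -[leLHS]ger0_norm ?(le_trans _ (TM x))//
  normrM normr_id.
Qed.

Lemma opnorm_ub1 (T : bop V) x : `|x| <= 1 -> `|T x| <= opnorm T.
Proof.
move=> x1; have [M M0 TM] := bop_bounded T.
apply: (@ksup_ub _ _ _ M); last by exists x.
move=> _ [y /= y1 <-]; rewrite normr_ge0 (le_trans (TM y))//.
by rewrite -[leRHS]mulr1 ler_wpM2l.
Qed.

Lemma opnorm_ge0 (T : bop V) : 0 <= opnorm T.
Proof. by apply: le_trans (opnorm_ub1 T (x := 0) _); rewrite ?normr0. Qed.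

Lemma opnorm_ub (T : bop V) x : `|T x| <= opnorm T * `|x|.
Proof.
have [->|x0] := eqVneq x 0; first by rewrite linear0 !normr0 mulr0.
have nx0 : 0 < `|x| by rewrite normr_gt0.
rewrite -ler_pdivrMr// mulrC.
have <- : `|T (`|x|^-1 *: x)| = `|x|^-1 * `|T x|.
  by rewrite linearZ /= normrZ ger0_norm// invr_ge0.
apply: opnorm_ub1; rewrite normrZ ger0_norm ?invr_ge0// mulVf//.
by rewrite normr_eq0.
Qed.

Lemma opnormD (S T : bop V) : opnorm (S + T) <= opnorm S + opnorm T.
Proof.
apply: opnorm_le => [|x]; first by rewrite addr_ge0 ?opnorm_ge0.
by rewrite mulrDl (le_trans (ler_normD _ _))// lerD ?opnorm_ub.
Qed.

Lemma opnormZ_le (a : K) (T : bop V) : opnorm (a *: T) <= `|a| * opnorm T.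
Proof.
apply: opnorm_le => [|x]; first by rewrite mulr_ge0 ?opnorm_ge0.
have -> : (a *: T) x = a *: T x by [].
by rewrite normrZ -mulrA ler_wpM2l// opnorm_ub.
Qed.

Lemma opnormZ (a : K) (T : bop V) : opnorm (a *: T) = `|a| * opnorm T.
Proof.
apply/le_anti; rewrite opnormZ_le /=.
have [->|a0] := eqVneq a 0; first by rewrite normr0 mul0r opnorm_ge0.
rewrite -ler_pdivlMl ?normr_gt0//.
have {1}-> : T = a^-1 *: (a *: T) by rewrite scalerA mulVf// scale1r.
by rewrite (le_trans (opnormZ_le _ _))// normfV.
Qed.

Lemma opnorm_eq0 (T : bop V) : opnorm T = 0 -> T = 0.
Proof.
move=> T0; apply/val_inj/funext => x /=; apply/eqP; rewrite -normr_le0.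
by rewrite (le_trans (opnorm_ub T x))// T0 mul0r.
Qed.

HB.instance Definition _ :=
  Lmodule_isNormed.Build K (bop V) opnormD opnormZ opnorm_eq0.

End operator_norm.

Section calkin.
Variables (R : realType) (k : scalar_kind).
Variable H : completeNormedModType (scalar_field R k).
Local Notation K := (scalar_field R k).
Local Open Scope quotient_scope.

Definition calkin := Quotient.quot (@compact_operator K H).

HB.instance Definition _ := GRing.Zmodule.on calkin.
HB.instance Definition _ := EqQuotient.on calkin.

Definition calkin_pi (T : bop H) : calkin := \pi_(calkin) T.

Lemma calkin_piB (S T : bop H) :
  (calkin_pi S = calkin_pi T) <-> (S - T \in @compact_operator K H).
Proof. by rewrite Quotient.idealrBE; split=> /eqP. Qed.

Lemma calkin_piP (q : calkin) : exists T, calkin_pi T = q.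
Proof. by exists (repr q); exact: reprK. Qed.

Lemma calkin_piD (S T : bop H) : calkin_pi (S + T) = calkin_pi S + calkin_pi T.
Proof. by rewrite /calkin_pi Quotient.pi_add. Qed.

Definition calkin_scale (a : K) (q : calkin) : calkin := calkin_pi (a *: repr q).

Lemma calkin_piZ (a : K) (T : bop H) :
  calkin_pi (a *: T) = calkin_scale a (calkin_pi T).
Proof.
apply/calkin_piB; rewrite -scalerBr rpredZ//; apply/calkin_piB.
by rewrite /calkin_pi reprK.
Qed.

Lemma calkin_scalerA (a b : K) q :
  calkin_scale a (calkin_scale b q) = calkin_scale (a * b) q.
Proof.
by have [T <-] := calkin_piP q; rewrite -!calkin_piZ scalerA.
Qed.

Lemma calkin_scale1r : left_id 1 calkin_scale.
Proof. by move=> q; have [T <-] := calkin_piP q; rewrite -calkin_piZ scale1r. Qed.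

Lemma calkin_scalerDr : right_distributive calkin_scale +%R.
Proof.
move=> a p q; have [S <-] := calkin_piP p; have [T <-] := calkin_piP q.
by rewrite -calkin_piD -!calkin_piZ scalerDr calkin_piD.
Qed.

Lemma calkin_scalerDl q : {morph calkin_scale^~ q : a b / a + b}.
Proof.
move=> a b; have [T <-] := calkin_piP q.
by rewrite -!calkin_piZ scalerDl calkin_piD.
Qed.

HB.instance Definition _ := GRing.Zmodule_isLmodule.Build K calkin
  calkin_scalerA calkin_scale1r calkin_scalerDr calkin_scalerDl.

Definition calkin_norm (q : calkin) : K :=
  kinf [set `|T| | T in [set T : bop H | calkin_pi T = q]].

Let fibre_neq0 q : [set `|T| | T in [set T : bop H | calkin_pi T = q]] !=set0.
Proof. by have [T Tq] := calkin_piP q; exists `|T|, T. Qed.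

Let fibre_ge0 q x : [set `|T| | T in [set T : bop H | calkin_pi T = q]] x -> 0 <= x.
Proof. by move=> [T _ <-]. Qed.

Lemma calkin_norm_le (T : bop H) : calkin_norm (calkin_pi T) <= `|T|.
Proof. by apply: kinf_lb; [exact: fibre_ge0|exists T]. Qed.

Lemma calkin_norm_ge0 q : 0 <= calkin_norm q.
Proof. by apply: kinf_ge; [exact: fibre_neq0| |exact: fibre_ge0]. Qed.

Lemma calkin_norm_adherent (q : calkin) (e : K) : 0 < e ->
  exists2 T : bop H, calkin_pi T = q & `|T| < calkin_norm q + e.
Proof.
move=> /(kinf_adherent (fibre_neq0 q) (@fibre_ge0 q))[_ [T Tq <-] Te].
by exists T.
Qed.

Lemma calkin_normD p q : calkin_norm (p + q) <= calkin_norm p + calkin_norm q.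
Proof.
apply/ler_addgt0Pr => e e0; have e20 : 0 < e / 2 by rewrite divr_gt0.
have [S <- Se] := calkin_norm_adherent p e20.
have [T <- Te] := calkin_norm_adherent q e20.
rewrite -calkin_piD (le_trans (calkin_norm_le _))// (le_trans (ler_normD _ _))//.
by rewrite [e]splitr addrACA lerD// ltW.
Qed.

Lemma calkin_normZ_le (a : K) q : calkin_norm (a *: q) <= `|a| * calkin_norm q.
Proof.
apply/ler_addgt0Pr => e e0.
have e'0 : 0 < e / (`|a| + 1) by rewrite divr_gt0// ltr_wpDl.
have [T Tq Te] := calkin_norm_adherent q e'0.
have -> : a *: q = calkin_pi (a *: T) by rewrite calkin_piZ Tq.
rewrite (le_trans (calkin_norm_le _))// normrZ.
rewrite (le_trans (ler_wpM2l _ (ltW Te)))// mulrDr lerD2l.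
by rewrite mulrCA -[leRHS]mulr1 ler_wpM2l ?(ltW e0)// ler_pdivrMr ?mul1r
  ?lerDl// ltr_wpDl.
Qed.

Lemma calkin_normZ (a : K) q : calkin_norm (a *: q) = `|a| * calkin_norm q.
Proof.
apply/le_anti; rewrite calkin_normZ_le /=.
have [->|a0] := eqVneq a 0; first by rewrite normr0 mul0r calkin_norm_ge0.
rewrite -ler_pdivlMl ?normr_gt0//.
have {1}-> : q = a^-1 *: (a *: q) by rewrite scalerA mulVf// scale1r.
by rewrite (le_trans (calkin_normZ_le _ _))// normfV.
Qed.

Lemma calkin_norm_eq0 q : calkin_norm q = 0 -> q = 0.
Proof.
move=> q0; have [T Tq] := calkin_piP q.
suff TK : T \in @compact_operator K H.
  rewrite -Tq -(_ : calkin_pi 0 = 0); last by rewrite /calkin_pi raddf0.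
  by apply/calkin_piB; rewrite subr0.
apply: compact_operator_closed => e e0.
have [S Sq] := calkin_norm_adherent q e0; rewrite q0 add0r => Se.
exists (T - S); first by apply/calkin_piB; rewrite Tq Sq.
move=> x x1.
have -> : T x - (T - S) x = S x by rewrite /= opprB addrC subrK.
exact: le_lt_trans (opnorm_ub1 _ x1) Se.
Qed.

HB.instance Definition _ := Lmodule_isNormed.Build K calkin
  calkin_normD calkin_normZ calkin_norm_eq0.

End calkin.

Definition ball_covering_property (K : numFieldType) (Y : normedModType K) :=
  exists (y : nat -> Y) (r : nat -> K),
    [/\ forall n, 0 < r n,
        [set x : Y | `|x| = 1] `<=` \bigcup_n ball (y n) (r n) &
        forall n, ~ ball (y n) (r n) 0].

(* Main.v *)
Require Import Defs.
From mathcomp Require Import all_boot all_order all_algebra.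
From mathcomp Require Import all_classical all_reals all_analysis.
From mathcomp Require Import complex sesquilinear ring.

(* If the open balls B(y_n, r_n) avoid 0, then r_n <= |y_n|, so it suffices to
   find a unit vector x of the Calkin algebra with |y_n - x| >= |y_n| for all n.
   Lift y_n to operators T_n. Changing T_n by a finite-rank operator does not
   change y_n, so the restriction of T_n to the orthogonal complement of any
   finite-dimensional subspace has norm at least |y_n|. Hence there is one
   orthonormal family consisting of vectors u_(n,j) and w_j such that
   |T_n u_(n,j)| >= (1 - 1/(j+1)) |y_n|. The class x of the orthogonal
   projection P onto the closed span of the w_j does the job: compact operators
   are small on some far vector of every orthonormal sequence, so that
   P w_j = w_j gives |x| = 1 and P u_(n,j) = 0 gives |y_n - x| >= |y_n|. *)

Set Implicit Arguments.
Unset Strict Implicit.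
Unset Printing Implicit Defensive.
Import Order.TTheory GRing.Theory Num.Theory.
Import numFieldNormedType.Exports.
Local Open Scope classical_set_scope.
Local Open Scope ring_scope.

(** * Archimedean property and compactness of discs for real and complex scalars *)

Section scalars.
Variables (R : realType) (k : scalar_kind).
Local Notation K := (scalar_field R k).

Lemma conj_scalar0 : conj_scalar (0 : K) = 0.
Proof. by case: k => //; exact: (rmorph0 (@conjc R)). Qed.

Lemma scalar_archi (x : K) : 0 <= x -> exists n : nat, x < n%:R.
Proof.
move=> x0; exists (Num.bound (to_real x)).
have: to_real x < (Num.bound (to_real x))%:R.
  by apply: archi_boundP; exact: to_real_ge0.
rewrite -(ltr_of_real k) to_realK//.
have -> // (n : nat) : of_real k n%:R = n%:R :> K.
by case: k {x x0} => //=; rewrite rmorph_nat.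
Qed.

Lemma continuous_of_realZ (V : normedModType K) (v : V) :
  continuous (fun a : R => of_real k a *: v).
Proof.
move=> a; apply/cvgrPdist_lt => d d0.
have v1 : 0 < `|v| + 1 by rewrite ltr_wpDl.
have dv0 : 0 < d / (`|v| + 1) by rewrite divr_gt0.
have d'0 : 0 < to_real (d / (`|v| + 1)).
  by rewrite -(ltr_of_real k) of_real0 to_realK// ltW.
near=> b; rewrite -scalerBl normrZ.
have -> : `|of_real k a - of_real k b| = of_real k `|a - b|.
  by case: k => //; rewrite -rmorphB normc_def/= expr0n addr0 sqrtr_sqr.
rewrite (@le_lt_trans _ _ (of_real k `|a - b| * (`|v| + 1)))//.
  by rewrite ler_wpM2l ?of_real_ge0// lerDl.
rewrite -ltr_pdivlMr// -[ltRHS]to_realK ?ltW// ltr_of_real.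
near: b; exact: cvgr_dist_lt.
Unshelve. all: by end_near. Qed.

Lemma of_real_segment_compact (V : normedModType K) (v : V) :
  compact [set of_real k a *: v | a in `[(-1 : R), 1]%classic].
Proof.
apply: continuous_compact; last exact: segment_compact.
by apply: continuous_subspaceT; exact: continuous_of_realZ.
Qed.
End scalars.

(** In the complex case [a *: v] splits into a real multiple of [v] plus a real multiple of
    ['i *: v], so the disc lies in the sum of two compact segments. *)
Lemma scalar_disc_compact (R : realType) (k : scalar_kind)
    (V : normedModType (scalar_field R k)) (v : V) :
  exists2 C, compact C & forall a : scalar_field R k, `|a| <= 1 -> C (a *: v).
Proof.
case: k V v => V v.
  exists [set a *: v | a in `[(-1 : R), 1]%classic].
    exact: (@of_real_segment_compact R real_scalars).
  by move=> a; rewrite ler_norml => a1; exists a => //=; rewrite in_itv.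
have cs := @of_real_segment_compact R complex_scalars V.
exists ((fun p : V * V => p.1 + p.2) @`
    ([set real_complex R a *: v | a in `[(-1 : R), 1]%classic] `*`
     [set real_complex R a *: ('i%C *: v) | a in `[(-1 : R), 1]%classic])).
  apply: continuous_compact; last by apply: compact_setX; exact: cs.
  apply: continuous_subspaceT => p.
  by apply: (@cvgD _ V _ (nbhs p)); [exact: cvg_fst|exact: cvg_snd].
move=> a a1; exists (real_complex R (complex.Re a) *: v,
                     real_complex R (complex.Im a) *: ('i%C *: v)) => /=.
  split; [exists (complex.Re a)|exists (complex.Im a)] => //.
    rewrite /= in_itv/= -ler_norml -(@lecR R).
    exact: le_trans (normc_ge_Re a) a1.
  rewrite /= in_itv/= -ler_norml -(@lecR R).
  (* Up to sign, the imaginary part of [a] is the real part of [a * 'i]. *)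
  rewrite -normrN -ReiNIm; apply: le_trans (normc_ge_Re _) _.
  by rewrite normrM [X in _ * X]normc_def/= expr0n add0r expr1n sqrtr1 mulr1.
by rewrite scalerA -scalerDl [in RHS](complexE a) [in RHS]mulrC.
Qed.


(** * Orthogonal projections onto finite orthonormal families *)

Section inner_product.
Variables (R : realType) (k : scalar_kind).
Local Notation K := (scalar_field R k).
Variables (H : completeNormedModType K) (dot : {dot H for @conj_scalar R k}).
Hypothesis normE : forall x : H, `|x| ^+ 2 = dot x x.

Lemma dotC x y : dot x y = conj_scalar (dot y x).
Proof. by rewrite hermitian_subproof expr0 mul1r. Qed.

Lemma dot_eq0C x y : dot x y = 0 -> dot y x = 0.
Proof. by rewrite [dot y x]dotC => ->; rewrite conj_scalar0. Qed.

Lemma dotDl x y z : dot (x + y) z = dot x z + dot y z.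
Proof. exact: linearDl. Qed.

Lemma dotDr x y z : dot z (x + y) = dot z x + dot z y.
Proof. exact: linearDr. Qed.

Lemma dotZl a x y : dot (a *: x) y = a * dot x y.
Proof. exact: linearZl_LR. Qed.

Lemma dotZr a x y : dot x (a *: y) = conj_scalar a * dot x y.
Proof. exact: linearZr_LR. Qed.

Lemma dotBl x y z : dot (x - y) z = dot x z - dot y z.
Proof. exact: linearBl. Qed.

Lemma dot_suml I (r : seq I) (P : pred I) (F : I -> H) y :
  dot (\sum_(i <- r | P i) F i) y = \sum_(i <- r | P i) dot (F i) y.
Proof. exact: linear_sumlz. Qed.

Lemma dot_sumr I (r : seq I) (P : pred I) (F : I -> H) y :
  dot y (\sum_(i <- r | P i) F i) = \sum_(i <- r | P i) dot y (F i).
Proof. exact: linear_sumr. Qed.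

Lemma pythagoras x y : dot x y = 0 -> `|x + y| ^+ 2 = `|x| ^+ 2 + `|y| ^+ 2.
Proof.
move=> xy; rewrite !normE dotDl !dotDr xy (dot_eq0C xy).
by rewrite addr0 add0r.
Qed.

Definition orthonormal_upto (e : nat -> H) (n : nat) :=
  forall i j, (i < n)%N -> (j < n)%N -> dot (e i) (e j) = (i == j)%:R.

(** When the first [n] vectors are orthonormal, this is the orthogonal projection onto their
    span. *)
Definition partial_fourier (e : nat -> H) (n : nat) (x : H) :=
  \sum_(i < n) dot x (e i) *: e i.

Lemma partial_fourier_linear e n : linear (partial_fourier e n).
Proof.
move=> a x y; rewrite /partial_fourier scaler_sumr -big_split /=.
apply: eq_bigr => i _; by rewrite dotDl dotZl scalerDl scalerA.
Qed.

Section upto.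
Variables (e : nat -> H) (n : nat) (on : orthonormal_upto e n).

Lemma dot_partial_fourier x j : (j < n)%N ->
  dot (partial_fourier e n x) (e j) = dot x (e j).
Proof.
move=> jn; rewrite /partial_fourier dot_suml (bigD1 (Ordinal jn))//=.
rewrite dotZl on// eqxx mulr1 big1 ?addr0// => i ij.
by rewrite dotZl on// -[_ == j]/(i == Ordinal jn) (negbTE ij) mulr0.
Qed.

Lemma dot_sub_partial_fourier x j : (j < n)%N ->
  dot (x - partial_fourier e n x) (e j) = 0.
Proof. by move=> jn; rewrite dotBl dot_partial_fourier// subrr. Qed.

Lemma sub_partial_fourier_norm x : `|x - partial_fourier e n x| ^+ 2 =
  `|x| ^+ 2 - `|partial_fourier e n x| ^+ 2.
Proof.
have xF : dot (x - partial_fourier e n x) (partial_fourier e n x) = 0.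
  rewrite [X in dot _ X]/partial_fourier dot_sumr big1// => i _.
  by rewrite dotZr dot_sub_partial_fourier// mulr0.
rewrite -[in X in _ = X - _](subrK (partial_fourier e n x) x).
by rewrite (pythagoras xF) addrK.
Qed.

Lemma partial_fourier_norm_le x : `|partial_fourier e n x| <= `|x|.
Proof.
rewrite -(@ler_pXn2r _ 2) ?nnegrE// -subr_ge0 -sub_partial_fourier_norm.
by rewrite exprn_ge0.
Qed.

Lemma partial_fourier_basis j : (j < n)%N -> partial_fourier e n (e j) = e j.
Proof.
move=> jn; rewrite /partial_fourier (bigD1 (Ordinal jn))//= on// eqxx scale1r.
rewrite big1 ?addr0// => i ij.
by rewrite on// eq_sym -[_ == j]/(i == Ordinal jn) (negbTE ij) scale0r.
Qed.

Lemma partial_fourier_comp m x : (m <= n)%N ->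
  partial_fourier e m (partial_fourier e n x) = partial_fourier e m x.
Proof.
move=> mn; apply: eq_bigr => i _.
by rewrite dot_partial_fourier// (leq_trans (ltn_ord i)).
Qed.

End upto.

Lemma orthonormal_uptoW e m n : (m <= n)%N ->
  orthonormal_upto e n -> orthonormal_upto e m.
Proof. by move=> mn on i j im jm; apply: on; exact: leq_trans mn. Qed.

Lemma partial_fourier_ortho e n x : (forall i, (i < n)%N -> dot x (e i) = 0) ->
  partial_fourier e n x = 0.
Proof. by move=> xe; apply: big1 => i _; rewrite xe// scale0r. Qed.

(** Cauchy-Schwarz against a unit vector, as Bessel's inequality for a one-element family. *)
Lemma norm_dot_le x u : `|u| = 1 -> `|dot x u| <= `|x|.
Proof.
move=> u1; have on : orthonormal_upto (fun=> u) 1.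
  by move=> [|//] [|//] _ _; rewrite -normE u1 expr1n.
have := partial_fourier_norm_le on x.
by rewrite /partial_fourier big_ord1 normrZ u1 mulr1.
Qed.

Lemma norm_normalize (x : H) : x != 0 -> `| `|x|^-1 *: x| = 1.
Proof.
move=> x0; rewrite normrZ ger0_norm ?invr_ge0// mulVf//.
by rewrite normr_eq0.
Qed.

(** If every vector equalled its projection, [n] vectors would span [H]. So some residual is
    nonzero, and it can be normalized. *)
Lemma ex_unit_ortho e n : ~ finite_dimensional H -> orthonormal_upto e n ->
  exists2 x, `|x| = 1 & forall i, (i < n)%N -> dot x (e i) = 0.
Proof.
move=> Hinf on; have /existsNP[y /eqP yF] :
    ~ forall y, y = partial_fourier e n y.
  by move=> yF; apply: Hinf; exists n, (fun i => e i) => y;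
    exists (fun i => dot y (e i)).
exists (`|y - partial_fourier e n y|^-1 *: (y - partial_fourier e n y)).
  by rewrite norm_normalize// subr_eq0.
by move=> i im; rewrite dotZl dot_sub_partial_fourier// mulr0.
Qed.

Lemma norm_sum_orthonormal e n : orthonormal_upto e n ->
  `|\sum_(i < n) e i| ^+ 2 = n%:R.
Proof.
elim: n => [|n IH] on; first by rewrite big_ord0 normr0 expr0n.
rewrite big_ord_recr/= pythagoras.
  rewrite IH; last exact: orthonormal_uptoW on.
  by rewrite normE on// eqxx -natr1.
rewrite dot_suml big1// => i _; rewrite on//; last by rewrite ltnS ltnW.
by rewrite (ltn_eqF (ltn_ord i)).
Qed.

(** * Compact operators on orthonormal sequences, and lower bounds for the Calkin norm *)

Definition orthonormal_seq (e : nat -> H) :=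
  forall i j, dot (e i) (e j) = (i == j)%:R.

Lemma orthonormal_seq_upto e n : orthonormal_seq e -> orthonormal_upto e n.
Proof. by move=> on i j _ _. Qed.

Lemma orthonormal_seq_norm e n : orthonormal_seq e -> `|e n| = 1.
Proof.
by move=> on; apply/eqP; rewrite -(@eqrXn2 _ 2)// normE on eqxx expr1n.
Qed.

Lemma orthonormal_seq_comp e (g : nat -> nat) : injective g ->
  orthonormal_seq e -> orthonormal_seq (e \o g).
Proof. by move=> gI on i j; rewrite /= on (inj_eq gI). Qed.

(* The average of n orthonormal vectors has norm 1/sqrt n, so T maps it close
   to 0, while it also maps it within d of p. *)
Lemma orthonormal_averaging (T : bop H) e p (d : K) : orthonormal_seq e ->
  0 < d -> (forall n, `|p - T (e n)| < d) -> `|p| <= d + d.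
Proof.
move=> on d0 Tp; rewrite real_leNgt ?ger0_real// ?addr_ge0 ?ltW//.
apply/negP => pd.
pose M := opnorm T; have M0 : 0 <= M := opnorm_ge0 T.
(* For [n > (M / d)^2], M sqrt n is less than [n * d], against the inequality reached below. *)
have [|n nM] := @scalar_archi R k ((M / d) ^+ 2).
  by rewrite exprn_ge0// divr_ge0// ltW.
have n0 : 0 < n%:R :> K.
  by apply: le_lt_trans nM; rewrite exprn_ge0// divr_ge0// ltW.
have : n%:R * `|p| <= M * `|\sum_(i < n) e i| + n%:R * d.
  have -> : n%:R * `|p| = `|T (\sum_(i < n) e i) + \sum_(i < n) (p - T (e i))|.
    rewrite linear_sum -big_split/= (eq_bigr (fun=> p)) => [|i _].
      by rewrite sumr_const card_ord normrMn mulr_natl.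
    by rewrite addrC subrK.
  rewrite (le_trans (ler_normD _ _))// lerD ?opnorm_ub//.
  rewrite (le_trans (ler_norm_sum _ _ _))//.
  have -> : n%:R * d = \sum_(i < n) d by rewrite sumr_const card_ord mulr_natl.
  by apply: ler_sum => i _; exact: ltW.
move=> /(lt_le_trans _) H1.
have {H1} : n%:R * (d + d) < M * `|\sum_(i < n) e i| + n%:R * d.
  by apply: H1; rewrite ltr_pM2l.
rewrite mulrDr ltrD2r => H1.
have : (n%:R * d) ^+ 2 < (M * `|\sum_(i < n) e i|) ^+ 2.
  by rewrite ltrXn2r// mulr_ge0 ?ltW.
rewrite !exprMn norm_sum_orthonormal; last exact: orthonormal_seq_upto.
rewrite expr2 -mulrA mulrC ltr_pM2r// => H2.
move: nM; rewrite expr_div_n ltr_pdivrMr ?exprn_gt0// => /lt_trans/(_ H2).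
by rewrite ltxx.
Qed.

(** By compactness the [T (e n)] have a cluster point [p]. Averaging along a subsequence whose
    images stay near [p] shows that [p] is small, hence so is some [T (e n)] with [n >= N]. *)
Lemma compact_orthonormal (T : bop H) e (d : K) N : orthonormal_seq e ->
  T \in @compact_operator K H -> 0 < d ->
  exists2 n, (N <= n)%N & `|T (e n)| < d.
Proof.
move=> on /compact_operatorP/precompactP[C TC cC] d0.
have e1 n : `|e n| = 1 by exact: orthonormal_seq_norm.
have [|p [Cp clp]] := cC ((fun n => T (e n)) @ \oo) _.
  by exists 0%N => // n _; apply: TC; exists (e n) => //=; rewrite e1.
have near_p r M : 0 < r -> exists2 n, (M <= n)%N & `|p - T (e n)| < r.
  move=> r0; have [||y [[n Mn <-] py]] :=
      clp [set T (e n) | n in [set n | (M <= n)%N]] (ball p r).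
  - by exists M => // n Mn; exists n.
  - exact: nbhsx_ballx.
  - by exists n => //; rewrite -ball_normE in py.
have d30 : 0 < d / 3%:R by rewrite divr_gt0.
(* Averaging with tolerance [d / 3] costs two thirds of [d]; the last third pays for the distance
   from [p] to [T (e n)]. *)
suff p_le : `|p| <= d / 3%:R + d / 3%:R.
  have [n Nn pn] := near_p _ N d30; exists n => //.
  rewrite -(subrK p (T (e n))) (le_lt_trans (ler_normD _ _))// distrC.
  by have -> : d = d / 3%:R + (d / 3%:R + d / 3%:R); [field|rewrite ltr_leD].
have /choice[f fP] : forall M, exists n,
    (M <= n)%N /\ `|p - T (e n)| < d / 3%:R.
  by move=> M; have [n] := near_p _ M d30; exists n.
(* Each index exceeds the previous one, so [e \o g] is again orthonormal. *)
pose g := fix g i := if i is i'.+1 then f (g i').+1 else f 0%N.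
have g_incr : {homo g : i j / (i < j)%N}.
  apply: homo_ltn => [|i]; first exact: ltn_trans.
  by have [] := fP (g i).+1.
have gI : injective g.
  by move=> i j gij; case: (ltngtP i j) => // /g_incr; rewrite gij ltnn.
apply: (@orthonormal_averaging T (e \o g)) => //.
  exact: orthonormal_seq_comp.
by case=> [|n] /=; [have [] := fP 0%N|have [] := fP (g n).+1].
Qed.

(** Every representative of the class differs from [S] by a compact operator, which is small at some
    far [e n]. That index is not under control, so the bound on [S] is asked for all large [n]. *)
Lemma calkin_norm_ge (S : bop H) e (c : K) : orthonormal_seq e -> 0 <= c ->
  (forall d, 0 < d -> exists N, forall n, (N <= n)%N -> c - d <= `|S (e n)|) ->
  c <= `|calkin_pi S|.
Proof.
move=> on c0 Sc; apply: kinf_ge => //; first by exists (`|S| : K); exists S.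
move=> _ [T /= TS <-]; apply/ler_addgt0Pr => d d0.
have d20 : 0 < d / 2 by rewrite divr_gt0.
have [N SN] := Sc _ d20.
have STK : S - T \in @compact_operator K H by apply/calkin_piB.
have [n Nn STn] := compact_orthonormal N on STK d20.
have := SN _ Nn; rewrite lerBlDr => /le_trans; apply.
rewrite [in leRHS](splitr d) addrA lerD2r.
rewrite -(subrK (T (e n)) (S (e n))) [leRHS]addrC (le_trans (ler_normD _ _))//.
apply: lerD; first exact: ltW.
by apply: opnorm_ub1; rewrite (orthonormal_seq_norm n on).
Qed.

(** * Finite-rank perturbations and almost norming vectors *)

Lemma rank_one_compact (u v : H) : `|u| = 1 ->
  exists2 S : bop H, S \in @compact_operator K H &
    forall x, S x = dot x u *: v.
Proof.
move=> u1; have Sb : (fun x => dot x u *: v) \in @bounded_operator K H.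
  apply/bounded_operatorP; split.
    by move=> a x y; rewrite dotDl dotZl scalerDl scalerA.
  by exists `|v| => x; rewrite normrZ mulrC ler_wpM2l// norm_dot_le.
exists (Bop Sb) => //; apply/compact_operatorP/precompactP.
have [C cC vC] := scalar_disc_compact v; exists C => // _ [x /= x1 <-].
by apply: vC; rewrite (le_trans (norm_dot_le x u1)).
Qed.

(** Composing [T] with the projection gives a sum of [n] operators of rank at most one. *)
Lemma partial_fourier_compact (T : bop H) e n : orthonormal_upto e n ->
  exists2 S : bop H, S \in @compact_operator K H &
    forall x, S x = T (partial_fourier e n x).
Proof.
move=> on; have e1 i : (i < n)%N -> `|e i| = 1.
  by move=> lt_in; apply/eqP; rewrite -(@eqrXn2 _ 2)// normE on// eqxx expr1n.
have /choice[S SP] : forall i : 'I_n, exists S : bop H,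
    S \in @compact_operator K H /\ forall x, S x = dot x (e i) *: T (e i).
  move=> i; have [S] := rank_one_compact (T (e i)) (e1 i (ltn_ord i)).
  by exists S.
exists (\sum_(i < n) S i) => [|x].
  by apply: rpred_sum => i _; have [] := SP i.
have -> : (\sum_(i < n) S i) x = \sum_(i < n) S i x.
  by elim/big_ind2: _ => // A a B b <- <-.
rewrite /partial_fourier linear_sum; apply: eq_bigr => i _.
by rewrite linearZ; have [_ ->] := SP i.
Qed.

(** Otherwise [T] is bounded by [c] on the orthogonal complement of the family. Subtracting from [T]
    its compact composite with the projection then leaves an operator of norm at most [c] in the
    same class. *)
Lemma ex_unit_ortho_ge (T : bop H) (c : K) e n : 0 <= c ->
  c < `|calkin_pi T| -> orthonormal_upto e n ->
  exists x, [/\ `|x| = 1, forall i, (i < n)%N -> dot x (e i) = 0 & c <= `|T x|].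
Proof.
move=> c0 cT on; apply: contrapT => nx.
have Tle x : `|x| = 1 -> (forall i, (i < n)%N -> dot x (e i) = 0) ->
    `|T x| <= c.
  move=> x1 xe; rewrite real_leNgt ?ger0_real//; apply/negP => cTx.
  by apply: nx; exists x; split => //; exact: ltW.
have [S SK SE] := partial_fourier_compact T on.
suff : `|calkin_pi T| <= c by move=> /(lt_le_trans cT); rewrite ltxx.
have -> : calkin_pi T = calkin_pi (T - S).
  by apply/calkin_piB; rewrite opprB addrC subrK.
apply: le_trans (calkin_norm_le _) _; apply: opnorm_le => // x.
have -> : (T - S) x = T (x - partial_fourier e n x).
  by rewrite linearB /= -SE.
have [->|z0] := eqVneq (x - partial_fourier e n x) 0.
  by rewrite linear0 normr0 mulr_ge0.
have zx : `|x - partial_fourier e n x| <= `|x|.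
  rewrite -(@ler_pXn2r _ 2) ?nnegrE// sub_partial_fourier_norm//.
  by rewrite gerBl exprn_ge0.
apply: le_trans (ler_wpM2l c0 zx).
rewrite -ler_pdivrMr ?normr_gt0// mulrC.
have := Tle _ (norm_normalize z0); rewrite linearZ normrZ ger0_norm ?invr_ge0//.
by apply=> i lt_in; rewrite dotZl dot_sub_partial_fourier// mulr0.
Qed.

(** * Projection onto the closed span of an orthonormal sequence *)

Lemma partial_fourier_cvg e x : orthonormal_seq e ->
  exists l : H, partial_fourier e n x @[n --> \oo] --> l.
Proof.
move=> on; have onn n := @orthonormal_seq_upto e n on.
suff : cauchy (partial_fourier e n x @[n --> \oo]) by move/cauchy_cvgP/cvg_ex.
apply: cauchy_exP => d d0.
(* The squared distances |x - F_n x|^2 decrease, and |F_n x - F_N x|^2 is the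
   difference of two of them. *)
pose A := [set `|x - partial_fourier e n x| ^+ 2 | n in [set: nat]].
have A_ge0 z : A z -> 0 <= z by move=> [n _ <-]; rewrite exprn_ge0.
have [|//|_ [N _ <-] NA] := @kinf_adherent R k A (d ^+ 2) _ A_ge0.
- by exists (`|x - partial_fourier e 0 x| ^+ 2), 0%N.
- by rewrite exprn_gt0.
exists (partial_fourier e N x), N => // n /= Nn.
rewrite -ball_normE /= -(@ltr_pXn2r _ 2) ?nnegrE ?(ltW d0)//.
rewrite distrC -(partial_fourier_comp (onn n) x Nn).
rewrite sub_partial_fourier_norm// partial_fourier_comp//.
have An : kinf A <= `|x - partial_fourier e n x| ^+ 2.
  by apply: kinf_lb => //; exists n.
rewrite -(ltrD2l (kinf A)) (le_lt_trans _ NA)//.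
rewrite [leRHS]sub_partial_fourier_norm// (le_trans (lerD An (lexx _)))//.
by rewrite sub_partial_fourier_norm// addrA subrK.
Qed.

(** [P] is the pointwise limit of the partial Fourier sums, so linearity and the norm bound pass to
    the limit. In the last two cases these sums are eventually constant. *)
Lemma orthonormal_projection e : orthonormal_seq e -> exists P : bop H,
  [/\ forall x, `|P x| <= `|x|, forall n, P (e n) = e n &
      forall x, (forall n, dot x (e n) = 0) -> P x = 0].
Proof.
move=> on; have onn n := @orthonormal_seq_upto e n on.
have /choice[P PE] := fun x => partial_fourier_cvg x on.
have P_unique x l : partial_fourier e n x @[n --> \oo] --> l -> P x = l.
  by move=> xl; apply: cvg_unique (PE x) xl; exact: norm_hausdorff.
have P_le x : `|P x| <= `|x|.
  apply/ler_addgt0Pr => d d0.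
  have /cvgrPdist_lt/(_ _ d0)[N _ /(_ N (leqnn N)) /= PN] := PE x.
  rewrite -(subrK (partial_fourier e N x) (P x)) (le_trans (ler_normD _ _))//.
  by rewrite addrC lerD ?(ltW PN)// partial_fourier_norm_le.
have Pb : P \in @bounded_operator K H.
  apply/bounded_operatorP; split; last by exists 1 => x; rewrite mul1r.
  move=> a x y; apply: P_unique.
  under eq_fun do rewrite partial_fourier_linear.
  by apply: cvgD; [apply: cvgZr; exact: PE|exact: PE].
exists (Bop Pb); split=> //= [n|x xe]; apply: P_unique; apply: cvg_near_cst.
  by exists n.+1 => // m /= nm; exact: partial_fourier_basis.
by exists 0%N => // m _; exact: partial_fourier_ortho.
Qed.

(** * Recursive choice of an orthonormal sequence *)

Lemma ex_orthonormal_seq (Q : nat -> H -> Prop) :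
  (forall n e, orthonormal_upto e n ->
    exists x, [/\ `|x| = 1, forall i, (i < n)%N -> dot x (e i) = 0 & Q n x]) ->
  exists2 e, orthonormal_seq e & forall n, Q n (e n).
Proof.
move=> Qex; have /choice[g gP] : forall s : seq H, exists x,
    orthonormal_upto (nth 0 s) (size s) ->
    [/\ `|x| = 1, forall i, (i < size s)%N -> dot x (nth 0 s i) = 0 &
        Q (size s) x].
  move=> s; have [on|non] := pselect (orthonormal_upto (nth 0 s) (size s)).
    by have [x] := Qex _ _ on; exists x.
  (* A dummy value for lists that are not orthonormal; the recursion never meets one. *)
  by exists 0 => /non.
(* [s n] lists the first [n] vectors, so the vector of index [i] is [g (s i)]. *)
pose s n := iter n (fun s => rcons s (g s)) [::].
have size_s n : size (s n) = n by elim: n => //= n IH; rewrite size_rcons IH.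
have nth_s n i : (i < n)%N -> nth 0 (s n) i = g (s i).
  elim: n => // n IH; rewrite ltnS leq_eqVlt /= nth_rcons size_s.
  by move=> /predU1P[->|i_n]; [rewrite ltnn eqxx|rewrite i_n IH].
have on n : orthonormal_upto (g \o s) n.
  elim: n => // n IH.
  have [|g1 gs _] := gP (s n).
    by move=> i j; rewrite size_s => i_n j_n; rewrite !nth_s//; exact: IH.
  have {}gs i : (i < n)%N -> dot (g (s n)) (g (s i)) = 0.
    by move=> i_n; rewrite -(nth_s n i)// gs ?size_s.
  move=> i j; rewrite !ltnS (leq_eqVlt i) (leq_eqVlt j).
  move=> /predU1P[->|i_n] /predU1P[->|j_n] /=.
  - by rewrite -normE g1 expr1n eqxx.
  - by rewrite gs// (gtn_eqF j_n).
  - by rewrite dot_eq0C ?gs// (ltn_eqF i_n).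
  - exact: IH.
exists (g \o s) => [i j|n]; first by
  apply: (on (maxn i j).+1); rewrite ltnS ?leq_maxl ?leq_maxr.
have [|_ _] := gP (s n); last by rewrite size_s.
by move=> i j; rewrite size_s => i_n j_n; rewrite !nth_s//; exact: (on n).
Qed.

End inner_product.

(** * A unit vector of the Calkin algebra outside every ball *)

Theorem corollary2p7 (R : realType) (k : scalar_kind)
    (H : completeNormedModType (scalar_field R k))
    (dot : {dot H for @conj_scalar R k})
    (normE : forall x : H, `|x| ^+ 2 = dot x x) :
  separable_space H ->
  ~ finite_dimensional H ->
  ~ ball_covering_property (calkin H).
Proof.
move=> _ Hinf [y [r [r0 cover n0]]]; pose K := scalar_field R k.
have ry n : r n <= `|y n|.
  rewrite real_leNgt ?ger0_real ?(ltW (r0 n))//; apply/negP => yr.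
  by apply: (n0 n); rewrite -ball_normE /ball_ /= subr0.
have y0 n : 0 < `|y n| := lt_le_trans (r0 n) (ry n).
have /choice[T Ty] := fun n => calkin_piP (y n).
(* One sequence carries the whole family: [(Some n, j)] codes u_(n,j), [(None, j)] codes w_j, and
   only the former carry a condition. The slack puts the bound strictly below [|y n|], and the
   denominator [j + 1] keeps it nonnegative. *)
pose Q m (x : H) : Prop :=
  if unpickle m is Some (Some n, j) then
    `|y n| - `|y n| / (j : nat).+1%:R <= `|T n x| else True.
have [m e on|e on eQ] := @ex_orthonormal_seq R k H dot normE Q.
  rewrite /Q; case: unpickle => [[[n|] j]|].
  - apply: (ex_unit_ortho_ge normE) => //.
      by rewrite subr_ge0 ler_pdivrMr// ler_peMr// ler1n.
    by rewrite Ty ltrBlDr ltrDl divr_gt0.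
  - by have [x] := ex_unit_ortho Hinf on; exists x.
  - by have [x] := ex_unit_ortho Hinf on; exists x.
(* [u (Some n)] is the sequence u_(n,j) and [u None] the sequence w_j. *)
pose u a j := e (pickle (a : option nat, j : nat)).
have on_u a : orthonormal_seq dot (u a).
  by apply: (orthonormal_seq_comp _ on) => i j /(pcan_inj pickleK)[].
have [P [P_le Pu P0]] := orthonormal_projection normE (on_u None).
have PX : `|calkin_pi P| = 1.
  apply/le_anti/andP; split.
    apply: le_trans (calkin_norm_le _) _; apply: opnorm_le => // x.
    by rewrite mul1r.
  apply: (calkin_norm_ge normE (on_u None)) => // d d0; exists 0%N => n _.
  by rewrite Pu (orthonormal_seq_norm normE) // gerBl ltW.
have [n _] := cover _ PX; rewrite -ball_normE /ball_ /=.
have -> : y n - calkin_pi P = calkin_pi (T n - P).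
  by apply/eqP; rewrite subr_eq -calkin_piD subrK Ty.
move=> /lt_le_trans/(_ (ry n)); apply/negP; rewrite -real_leNgt ?ger0_real//.
apply: (calkin_norm_ge normE (on_u (Some n))) => // d d0.
(* For [j >= N] the slack [|y n| / (j + 1)] is at most [d]. *)
have [|N yN] := @scalar_archi R k (`|y n| / d); first by rewrite divr_ge0// ltW.
exists N => j Nj.
have TPE x : (T n - P) x = T n x - P x by [].
(* [P] kills u_(n,j), which is orthogonal to every w_i since their codes differ. *)
rewrite TPE P0 ?subr0 => [|i]; last by rewrite on (inj_eq (pcan_inj pickleK)).
have := eQ (pickle (Some n, j)); rewrite /Q pickleK; apply: le_trans.
rewrite lerD2l lerN2 ler_pdivrMr// mulrC -ler_pdivrMr//.
by rewrite (le_trans (ltW yN))// ler_nat ltnW.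
Qed.
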